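(* Suppose that $\kappa$ is an uncountable cardinal of countable cofinality. Then the Banach space $\ell_1(\kappa)$ does not admit any normal disjoint tiling by bodies of the form $X+B$, where $X\subseteq\ell_1(\kappa)$ is closed and norm-separable (depending on the tile) and $B$ is the unit ball of $\ell_1(\kappa)$.
   Context: For a cardinal $\kappa$, $\ell_1(\kappa)=\{x\in\mathbb{R}^\kappa:\|x\|<\infty\}$ with norm $\|x\|=\sum_{\alpha\in\kappa}|x(\alpha)|$. The unit ball is $B=\{x\in\ell_1(\kappa):\|x\|\le 1\}$, and $X+B=\{x+b:x\in X,\ b\in B\}$. A tiling of a normed space is a cover of it by closed sets (called tiles) such that every tile has nonempty interior and the interiors of any two distinct tiles are disjoint. A tiling is disjoint if distinct tiles are disjoint. A tiling is normal if there are $0<r<R$ such that every tile contains a ball of radius $r$ and is contained in a ball of radius $R$. A body is a closed set which is the closure of its interior. *)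

(* Defs.v *)
From HB Require Import structures.
From mathcomp Require Import all_boot all_order all_algebra.
From mathcomp Require Import boolp classical_sets functions cardinality fsbigop.
From mathcomp Require Import wochoice reals constructive_ereal ereal esum.
From mathcomp Require Import topology normedtype.

Set Implicit Arguments.
Unset Strict Implicit.
Unset Printing Implicit Defensive.

Import Order.TTheory GRing.Theory Num.Theory.
Import numFieldNormedType.Exports.
Local Open Scope classical_set_scope.
Local Open Scope ring_scope.

(* A cardinal is represented by an index type K of that cardinality. *)
Section Cardinal.
Variable K : choiceType.

(* le turns K into a copy of the initial ordinal of its cardinality: it is a
   well-order all of whose proper initial segments are strictly smaller. *)
Definition initial_ordinal (le : rel K) :=
  well_order le /\
  forall x, ~ ([set: K] #<= [set y | y != x /\ le y x])%card.

Definition cofinal (le : rel K) (C : set K) :=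
  forall x, exists2 y, C y & le x y.

(* The choice of le is immaterial: any two are isomorphic. *)
Definition countable_cofinality :=
  exists2 le : rel K, initial_ordinal le &
    exists2 C : set K, countable C & cofinal le C.

End Cardinal.

Section Ell1.
Variables (R : realType) (K : choiceType).

Definition ell1_pred : {pred K -> R} :=
  [pred f : K -> R | summable [set: K] (EFin \o f)].

Definition esum_norm (f : K -> R) : \bar R :=
  (\esum_(i in [set: K]) `|(f i)%:E|)%E.

Lemma esum_norm_ge0 f : (0 <= esum_norm f)%E.
Proof. by apply: esum_ge0 => i _; exact: abse_ge0. Qed.

Lemma esum_normD (f g : K -> R) :
  (esum_norm (f + g)%R <= esum_norm f + esum_norm g)%E.
Proof.
rewrite /esum_norm -esumD; [|by move=> i _; exact: abse_ge0..].
by apply: le_esum => i _; rewrite -EFinD lee_fin; exact: ler_normD.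
Qed.

Lemma esum_normZ_le (a : R) f :
  (esum_norm (a *: f)%R <= `|a|%:E * esum_norm f)%E.
Proof.
apply: ge_ereal_sup => _ [A [finA AK] <-].
rewrite (eq_fsbigr (fun i => `|a|%:E * `|(f i)%:E|)%E); last first.
  by move=> i _; rewrite /= -EFinM; congr EFin; exact: normrM.
rewrite -ge0_mule_fsumr; last by move=> i; exact: abse_ge0.
apply: lee_wpmul2l; first by rewrite lee_fin.
by apply: ereal_sup_ubound; exists A.
Qed.

Lemma ell1_submod_closed : submod_closed ell1_pred.
Proof.
split=> [|a f g]; rewrite !inE /summable.
  rewrite esum1 ?ltry// => i _.
  by rewrite /= normr0.
move=> hf hg; apply: le_lt_trans (esum_normD _ _) _; apply: lte_add_pinfty => //.
apply: le_lt_trans (esum_normZ_le _ _) _.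
by rewrite lte_mul_pinfty// lee_fin.
Qed.

HB.instance Definition _ :=
  GRing.isSubmodClosed.Build R (K -> R) ell1_pred ell1_submod_closed.

Record ell1 := Ell1 {
  ell1_fun :> K -> R;
  ell1P : ell1_fun \in ell1_pred
}.

HB.instance Definition _ := [isSub for ell1_fun].
HB.instance Definition _ := [Choice of ell1 by <:].
HB.instance Definition _ := [SubChoice_isSubLmodule of ell1 by <:].

Definition ell1_norm (f : ell1) : R := fine (esum_norm f).

Lemma ell1_normE (f : ell1) : (ell1_norm f)%:E = esum_norm f.
Proof.
rewrite fineK// ge0_fin_numE ?esum_norm_ge0//.
by have := ell1P f; rewrite inE.
Qed.

Lemma ell1_normD (f g : ell1) : ell1_norm (f + g) <= ell1_norm f + ell1_norm g.
Proof. by rewrite -lee_fin EFinD !ell1_normE; exact: esum_normD. Qed.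

Lemma ell1_normZ (a : R) (f : ell1) : ell1_norm (a *: f) = `|a| * ell1_norm f.
Proof.
have le (b : R) (h : ell1) : ell1_norm (b *: h) <= `|b| * ell1_norm h.
  by rewrite -lee_fin EFinM !ell1_normE; exact: esum_normZ_le.
apply/eqP; rewrite eq_le le /=.
have [->|a0] := eqVneq a 0.
  by rewrite normr0 mul0r fine_ge0// esum_norm_ge0.
rewrite -ler_pdivlMl ?normr_gt0// -normfV.
by rewrite -{1}[f]scale1r -(mulVf a0) -scalerA; exact: le.
Qed.

Lemma ell1_norm0_eq0 (f : ell1) : ell1_norm f = 0 -> f = 0.
Proof.
move=> f0; apply/val_inj/funext => i.
have : (`|(f i)%:E| <= esum_norm f)%E.
  apply: esum_ge; exists [set i]; first by split.
  by rewrite fsbig_set1.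
by rewrite -ell1_normE f0 lee_fin normr_le0 => /eqP.
Qed.

HB.instance Definition _ :=
  Lmodule_isNormed.Build R ell1 ell1_normD ell1_normZ ell1_norm0_eq0.

End Ell1.

Section Topological.
Variable V : topologicalType.

Definition separable_set (X : set V) :=
  exists D : set V, [/\ countable D, D `<=` X & X `<=` closure D].

Definition body (A : set V) := closed A /\ closure A^° = A.

Definition tiling (T : set (set V)) :=
  [/\ \bigcup_(A in T) A = [set: V],
      forall A, T A -> closed A,
      forall A, T A -> A^° !=set0 &
      trivIset T (fun A : set V => A^°)].

Definition disjoint_tiling (T : set (set V)) := tiling T /\ trivIset T id.

End Topological.

Section Normed.
Variables (R : realType) (V : normedModType R).

Definition unit_ball : set V := [set b | `|b| <= 1].

Definition sum_set (X Y : set V) : set V := [set x + y | x in X & y in Y].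

Definition normal_tiling (T : set (set V)) :=
  tiling T /\
  exists r s : R, [/\ 0 < r, r < s &
    forall A, T A -> (exists x, closed_ball x r `<=` A) /\
                     (exists x, A `<=` closed_ball x s)].

End Normed.

Arguments unit_ball {R} V.

(* Main.v *)
Require Import Defs.
From mathcomp Require Import all_boot all_order all_algebra.
From mathcomp Require Import boolp classical_sets functions cardinality.
From mathcomp Require Import reals topology normedtype.
From mathcomp Require Import fsbigop wochoice constructive_ereal ereal esum.
From mathcomp Require Import sequences lra.
Local Open Scope classical_set_scope.

(** The proof diagonalises against the tiles along a path of axis-parallel
moves.  Each tile is A = X + B with X separable, so all centres x in X vanish
off a countable set of coordinates, the support of A; hence every
nonnegative z satisfies |z + t e_a - x| = |z - x| + t whenever t >= 0 and a lies
off the support of A.  Adding mass to fresh coordinates therefore leaves A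
after a move of size about 1 - d(z, X), and A is never entered again by
increasing other fresh coordinates.

Such moves must have a finite total size.  Disjointness of the tiles provides
it: a point of A is at distance more than 1 from every centre of every other
tile, so a move that overshoots the boundary of A by at most e stops at a
point whose distance to all centres is at least 1 - e ([leave_tile]).  The next
move, overshooting by e / 2, thus has length at most 3 e / 2.  Taking
e = 2^-n at stage n gives a bounded, coordinatewise increasing
path z_0, z_1, ... whose limit w is in l1.

For w to escape all tiles, the n-th coordinate a_n must avoid the supports
of more and more tiles, eventually of each of them.  Every tile contains a
finitely supported vector with rational entries and is determined by it.
Countable cofinality exhausts the index set K by sets L_n into which K does
not embed ([small_exhaustion]).  The finite sequences in L_n index
countable supports whose union cannot be all of K ([small_index_union]);
this uses that kappa * kappa = kappa for an infinite cardinal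
([infinite_pairing]).  So a_n can be chosen off the supports of all tiles that
meet a rational vector carried by L_n.

Finally, let w be in a tile A = X + B that meets a rational vector carried by
L_n, and let |w - x| <= 1 with x in X.  For m >= n, w agrees with z_m on the
support of A, and off it x vanishes and 0 <= z_m <= w.  Hence
|z_m - x| <= |w - x| <= 1, so A contains both z_n and z_n+1.  But z_n+1 was
chosen outside the tile of z_n, a contradiction ([no_point_left]). *)

Set Implicit Arguments.
Unset Strict Implicit.
Unset Printing Implicit Defensive.

(** * Cardinal arithmetic *)

(** A maximal partial injection, seen as a graph, cannot miss a point on both
sides. *)
Lemma injection_total (X Y : Type) :
  (exists f : X -> Y, injective f) \/ (exists g : Y -> X, injective g).
Proof.
pose P (G : set (X * Y)) := forall u v, G u -> G v -> u.1 = v.1 <-> u.2 = v.2.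
have [F FP totF|G [PG maxG]] := @Zorn_bigcup _ P.
  move=> u v [G FG Gu] [H FH Hv].
  by have [GH|HG] := totF _ _ FG FH; [apply: (FP H)|apply: (FP G)]; auto.
have [domG|/existsNP[x xG]] := pselect (forall x, exists y, G (x, y)).
  left; have [f fG] := choice domG; exists f => x x' fxx'.
  by apply/(PG _ _ (fG x) (fG x')).
have [ranG|/existsNP[y yG]] := pselect (forall y, exists x, G (x, y)).
  right; have [g gG] := choice ranG; exists g => y y' gyy'.
  by apply/(PG _ _ (gG y) (gG y')).
exfalso; apply: (maxG ((x, y) |` G)).
  by split=> [?|/(_ (x, y)) Gxy]; [right|apply: xG; exists y; apply: Gxy; left].
move=> u v [->|Gu] [->|Gv] //=; [| |exact: PG].
- by split=> e; exfalso; [apply: xG; exists v.2|apply: yG; exists v.1];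
    rewrite e -surjective_pairing.
- by split=> e; exfalso; [apply: xG; exists u.2|apply: yG; exists u.1];
    rewrite -e -surjective_pairing.
Qed.

Lemma sval_inj (A : Type) (P : A -> Prop) : injective (@sval A P).
Proof. by move=> [x Px] [y Py] /= xy; exact: eq_exist. Qed.

Definition pairing_on (A : Type) (B : set A) (p : A -> A -> A) :=
  (forall x y, B x -> B y -> B (p x y)) /\
  forall x y x' y', B x -> B y -> B x' -> B y' ->
    p x y = p x' y' -> x = x' /\ y = y'.

(** Zorn's lemma applied to pairings of subsets, ordered by extension.  Each
subset is required to contain the copy i of the natural numbers so that the
maximal one is infinite. *)
Lemma pairing_maximal (A : Type) (i : nat -> A) : injective i ->
  exists B (p : A -> A -> A), [/\ range i `<=` B, pairing_on B p &
    forall C q, pairing_on C q -> B `<=` C ->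
      (forall x y, B x -> B y -> q x y = p x y) -> C `<=` B].
Proof.
move=> inj_i.
pose S := {Bp : set A * (A -> A -> A) |
  range i `<=` Bp.1 /\ pairing_on Bp.1 Bp.2}.
pose mk B p (iB : range i `<=` B) (pB : pairing_on B p) : S :=
  exist (fun Bp => range i `<=` Bp.1 /\ pairing_on Bp.1 Bp.2)
    (B, p) (conj iB pB).
pose R (s t : S) := `[< (sval s).1 `<=` (sval t).1 /\
  forall x y, (sval s).1 x -> (sval s).1 y ->
    (sval t).2 x y = (sval s).2 x y >].
have [s0 _] : exists s : S, True.
  have [g gK] : exists g : A -> nat, cancel i g.
    have gex a : exists n, (exists m, i m = a) -> i n = a.
      have [[m im]|nm] := pselect (exists m, i m = a); first by exists m.
      by exists 0%N.
    have [g gP] := choice gex.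
    by exists g => n; apply: inj_i; apply: gP; exists n.
  suff i_pairing : pairing_on (range i) (fun x y => i (pickle (g x, g y))).
    by exists (mk _ _ (@subset_refl _ _) i_pairing).
  split=> [x y _ _|_ _ _ _ [m _ <-] [n _ <-] [m' _ <-] [n' _ <-]].
    by exists (pickle (g x, g y)).
  by rewrite !gK => /inj_i /(pcan_inj pickleK)[-> ->].
have Rrefl t : R t t by apply/asboolP; split.
have Rtrans r s t : R r s -> R s t -> R r t.
  move=> /asboolP[rs ers] /asboolP[st est]; apply/asboolP; split.
    exact: subset_trans st.
  by move=> x y rx ry; rewrite est ?ers//; exact: rs.
have [|t tmax] := ZL_preorder s0 Rrefl Rtrans; last first.
  case: t tmax => [[B p] /= [iB pB]] tmax; exists B, p; split=> // C q qC BC qp.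
  by have /tmax/asboolP[] : R (mk B p iB pB) (mk C q (subset_trans iB BC) qC)
    by exact/asboolP.
move=> F totF.
have [|F0] := pselect (exists s, F s); last first.
  by exists s0 => s Fs; case: F0; exists s.
move=> [s1 Fs1].
(* The upper bound of a nonempty chain F: finitely many points of the union B
   lie in a common member, whose pairing is the one to use. *)
pose B := [set x | exists2 s, F s & (sval s).1 x].
pose p x y z := exists s, [/\ F s, (sval s).1 x, (sval s).1 y &
  z = (sval s).2 x y].
have common s t : F s -> F t -> exists2 u, F u &
    (sval s).1 `|` (sval t).1 `<=` (sval u).1.
  move=> Fs Ft; have [/asboolP[st _]|/asboolP[ts _]] := totF _ _ Fs Ft.
    by exists t => // x [/st|].
  by exists s => // x [|/ts].
have common2 x y : B x -> B y ->
    exists2 s, F s & (sval s).1 x /\ (sval s).1 y.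
  move=> [s Fs sx] [t Ft ty]; have [u Fu stu] := common _ _ Fs Ft.
  by exists u => //; split; apply: stu; [left|right].
have fex (u : A * A) : exists z, B u.1 -> B u.2 -> p u.1 u.2 z.
  have [[B1 B2]|nB] := pselect (B u.1 /\ B u.2); last first.
    by exists u.1 => *; case: nB.
  have [s Fs [s1u s2u]] := common2 _ _ B1 B2.
  by exists ((sval s).2 u.1 u.2) => _ _; exists s.
have [f fP] := choice fex.
have fE s x y : F s -> (sval s).1 x -> (sval s).1 y ->
    f (x, y) = (sval s).2 x y.
  move=> Fs sx sy.
  have [||t [Ft tx ty ->]] := fP (x, y); [by exists s..|].
  by have [/asboolP[_ ->]|/asboolP[_ ->]] := totF _ _ Fs Ft.
have iB : range i `<=` B.
  by move=> a ia; exists s1 => //; apply: (svalP s1).1.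
suff fB : pairing_on B (fun x y => f (x, y)).
  exists (mk _ _ iB fB) => s Fs.
  apply/asboolP; split=> [x sx|x y sx sy] /=; first by exists s.
  exact: fE.
split=> [x y Bx By|x y x' y' Bx By Bx' By'].
  have [s Fs [sx sy]] := common2 _ _ Bx By.
  rewrite (fE s)//; exists s => //; exact: (svalP s).2.1.
have [s Fs [sx sy]] := common2 _ _ Bx By.
have [t Ft [tx' ty']] := common2 _ _ Bx' By'.
have [u Fu stu] := common _ _ Fs Ft.
have [[ux uy] [ux' uy']] : ((sval u).1 x /\ (sval u).1 y) /\
    ((sval u).1 x' /\ (sval u).1 y').
  by split; split; apply: stu; do [by left|by right].
by rewrite !(fE u)//; apply: (svalP u).2.2.
Qed.

(** Let B carry a maximal pairing.  If the complement of B embeds in B, then so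
does the whole type, since B absorbs two copies of itself.  Otherwise the
complement contains a copy f B of B, and the pairing extends to the union of B
and f B, against maximality. *)
Lemma infinite_pairing (A : Type) (i : nat -> A) : injective i ->
  exists p : A -> A -> A, forall x y x' y', p x y = p x' y' -> x = x' /\ y = y'.
Proof.
move=> inj_i; have [B [p [iB [pB pI] maxB]]] := pairing_maximal inj_i.
pose b0 := i 0%N; pose b1 := i 1%N.
have Bb0 : B b0 by apply: iB; exists 0%N.
have Bb1 : B b1 by apply: iB; exists 1%N.
have b01 : b0 <> b1 by move=> /inj_i.
have [[e e_inj]|[e e_inj]] := injection_total {x | ~ B x} {x | B x}.
  pose h x := if pselect (B x) is right nBx
    then p b1 (sval (e (exist _ x nBx))) else p b0 x.
  have Bh x : B (h x).
    by rewrite /h; case: pselect => Bx; apply: pB => //; exact: svalP.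
  have h_inj : injective h.
    move=> x y; rewrite /h; case: pselect => Bx; case: pselect => By.
    - by case/pI.
    - by case/pI => //; exact: svalP.
    - by case/pI => //; [exact: svalP|move=> /esym].
    - by case/pI; [|exact: svalP| |exact: svalP|move=> _ /sval_inj/e_inj[]].
  exists (fun x y => p (h x) (h y)) => x y x' y'.
  by case/pI => // /h_inj-> /h_inj->.
have [f [r [fB rf]]] : exists f r : A -> A,
    (forall x, B x -> ~ B (f x)) /\ (forall x, B x -> r (f x) = x).
  pose f x := if pselect (B x) is left Bx then sval (e (exist _ x Bx)) else x.
  have f_inj x y : B x -> B y -> f x = f y -> x = y.
    rewrite /f; case: pselect => // Bx _; case: pselect => // By _.
    by move=> /sval_inj/e_inj[].
  have rex a : exists b, forall c, B c -> f c = a -> c = b.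
    have [[c [Bc ca]]|nc] := pselect (exists c, B c /\ f c = a); last first.
      by exists a => c Bc ca; case: nc; exists c.
    by exists c => d Bd da; apply: f_inj => //; rewrite da.
  have [r rP] := choice rex; exists f, r.
  split=> x Bx; last by rewrite -(rP _ x).
  by rewrite /f; case: pselect => // Bx'; exact: (svalP (e _)).
pose C := B `|` f @` B.
(* Pairs of B keep their code.  Any other pair of C is coded in f @` B: both
   components are brought back to B by s, and t tags where they came from. *)
pose t x := if pselect (B x) is left _ then b0 else b1.
pose s x := if pselect (B x) is left _ then x else r x.
have Bt x : B (t x) by rewrite /t; case: pselect.
have Bs x : C x -> B (s x).
  rewrite /s => Cx; case: pselect => // nBx; case: Cx => // -[y By <-].
  by rewrite rf.
have ts_inj x y : C x -> C y -> t x = t y -> s x = s y -> x = y.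
  rewrite /t /s => Cx Cy; case: pselect => Bx; case: pselect => By //.
  - by move/esym.
  - case: Cx => // -[x' Bx' <-]; case: Cy => // -[y' By' <-].
    by rewrite !rf // => _ ->.
pose q0 x y := p (p (t x) (t y)) (p (s x) (s y)).
pose q x y := if pselect (B x /\ B y) is left _ then p x y else f (q0 x y).
have Bq0 x y : C x -> C y -> B (q0 x y).
  by move=> /Bs Bsx /Bs Bsy; rewrite /q0; do 2!apply: (pB).
have qC : pairing_on C q.
  split=> [x y Cx Cy|x y x' y' Cx Cy Cx' Cy'].
    rewrite /q; case: pselect => [[Bx By]|_]; first by left; exact: pB.
    by right; exists (q0 x y) => //; exact: Bq0.
  rewrite /q; case: pselect => [[Bx By]|_]; case: pselect => [[Bx' By']|_].
  - exact: pI.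
  - move=> e0; exfalso; apply: (fB (q0 x' y')); first exact: Bq0.
    by rewrite -e0; exact: pB.
  - move=> e0; exfalso; apply: (fB (q0 x y)); first exact: Bq0.
    by rewrite e0; exact: pB.
  - move=> /(congr1 r); rewrite !rf; do ?exact: Bq0.
    have [Bx By Bx' By'] := And4 (Bs _ Cx) (Bs _ Cy) (Bs _ Cx') (Bs _ Cy').
    case/pI; [by apply: pB..|].
    by move=> /pI[]// tx ty /pI[]// sx sy; split; apply: ts_inj.
exfalso; apply: (fB b0) => //; apply: (maxB C q) => //.
- by move=> x; left.
- by move=> x y Bx By; rewrite /q; case: pselect => // -[].
- by right; exists b0.
Qed.

(** Iterating a pairing codes the sequences of a given length injectively; the
length is recorded separately. *)
Lemma infinite_seq_code (A : Type) (i : nat -> A) : injective i ->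
  exists c : seq A * nat -> A, injective c.
Proof.
move=> inj_i; have [p pI] := infinite_pairing inj_i.
pose c s := foldr p (i 0%N) s.
have c_inj s s' : size s = size s' -> c s = c s' -> s = s'.
  elim: s s' => [|x s IH] [|x' s']//= [/IH sz] /pI[-> /sz ->//].
exists (fun u => p (p (i (size u.1)) (i u.2)) (c u.1)).
by move=> [s n] [s' n'] /pI[/pI[/inj_i sz /inj_i/= ->]] /c_inj ->.
Qed.

Lemma card_le_of_inj (T U : Type) (A : set T) (B : set U) (f : T -> U) :
  (forall x, A x -> B (f x)) -> {in A &, injective f} -> (A #<= B)%card.
Proof.
move=> AB fI; have : $|{injfun A >-> B}|.
  by apply/injfunPex; exists f.
by case=> g; exact: inj_card_le.
Qed.

Lemma setT_card_le_inj (T U : Type) (B : set U) : ([set: T] #<= B)%card ->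
  exists f : T -> {x | B x}, injective f.
Proof.
move=> /card_leP[f]; pose g x := f (exist _ x (mem_setT x)).
exists (fun x => exist _ (sval (g x)) (set_mem (svalP (g x)))) => x y.
by move=> [/sval_inj/inj]; rewrite !in_setT => /(_ isT isT)[].
Qed.

(** If such a union were everything, then each point of K would be determined by
a sequence in L and its rank in an enumeration of the corresponding countable
set.  For L infinite, coding these data injects K into L; for L finite, K is a
countable union of countable sets. *)
Lemma small_index_union (K : choiceType) (L : set K) (F : seq K -> set K) :
  ~ countable [set: K] -> ~ ([set: K] #<= L)%card ->
  (forall s, countable (F s)) ->
  exists a, forall s, (forall x, x \in s -> L x) -> ~ F s a.
Proof.
move=> Kunc KL Fc; apply/not_existsP => Fcover.
have {}Fcover a : exists s : seq K, (forall x, x \in s -> L x) /\ F s a.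
  have /existsNP[s /not_implyP[sL /contrapT Fsa]] := Fcover a.
  by exists s.
have [S SP] := choice Fcover.
have [Lc|Linf] := pselect (finite_set L).
  apply: Kunc; have /countable_injP[g gI] := finite_set_countable Lc.
  have Sc : countable (range S).
    apply/countable_injP; exists (fun s => pickle (map g s)).
    move=> s s' /set_mem[a _ <-] /set_mem[b _ <-] /(pcan_inj pickleK).
    have SL u : all [in L] (S u).
      by apply/allP => x xs; apply/mem_set; exact: (SP u).1.
    by apply: (inj_in_map gI); exact: SL.
  have -> : [set: K] = \bigcup_(s in range S) F s.
    by apply/seteqP; split=> // a _; exists (S a); [exists a|exact: (SP a).2].
  exact: bigcup_countable.
have [i iI] := setT_card_le_inj ((infiniteP _).1 Linf).
have [c cI] := infinite_seq_code iI.
have nex s : exists n : K -> nat, {in F s &, injective n}.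
  exact/countable_injP.
have [n nP] := choice nex.
have lift a : exists t : seq {x | L x}, map sval t = S a.
  move: (S a) (SP a).1; elim=> [_|x s IH sL]; first by exists [::].
  have [|t ts] := IH; first by move=> y ys; apply: sL; rewrite inE ys orbT.
  by exists (exist _ x (sL x (mem_head x s)) :: t); rewrite /= ts.
have [t tS] := choice lift.
apply: KL.
apply: (@card_le_of_inj _ _ _ _ (fun a => sval (c (t a, n (S a) a)))).
  by move=> a _; exact: svalP.
move=> a b _ _ /sval_inj/cI[tab].
have Sab : S a = S b by rewrite -!tS tab.
by rewrite -Sab; apply: nP; apply/mem_set;
  rewrite ?[in F (S a) b]Sab; exact: (SP _).2.
Qed.

Section Segments.
Variables (K : choiceType) (le : rel K).
Hypotheses (Kunc : ~ countable [set: K]) (le_ini : initial_ordinal le).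

(** Adding the endpoint to a strict segment is harmless: given an injection f of
K into the closed segment, the preimages under f of m and of the points of the
strict segment form countable sets indexed by finite sequences. *)
Lemma closed_segment_small m : ~ ([set: K] #<= [set y | le y m])%card.
Proof.
move=> /setT_card_le_inj[f fI].
pose F s := [set x | sval (f x) \in m :: s].
have Fc s : countable (F s).
  apply: sub_countable (finite_set_countable (finite_seq (m :: s))).
  apply: (@card_le_of_inj _ _ _ _ (fun x => sval (f x))) => // x y _ _.
  by move/sval_inj/fI.
have [a aP] := small_index_union Kunc (le_ini.2 m) Fc.
have fa : sval (f a) != m.
  by apply/eqP => fam; apply: (aP [::]) => //; rewrite /F/= fam inE.
apply: (aP [:: sval (f a)]); last by rewrite /F/= !inE eqxx orbT.
by move=> x; rewrite inE => /eqP->; split=> //; exact: (svalP (f a)).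
Qed.

(** Running maxima along an enumeration of the cofinal set turn the closed
segments below its points into an increasing sequence. *)
Lemma small_exhaustion (C : set K) : countable C -> cofinal le C ->
  exists L : nat -> set K, [/\ forall n, ~ ([set: K] #<= L n)%card,
    (forall n, L n `<=` L n.+1) & \bigcup_n L n = setT].
Proof.
move=> /countable_injP[g gI] Ccof.
have wo : wo_chain le predT by apply: withinW; exact: le_ini.1.
have le_refl x : le x x by exact: (wo_chain_reflexive wo).
have le_anti x y : le x y -> le y x -> x = y.
  by move=> xy yx; apply: (wo_chain_antisymmetric wo) => //; rewrite xy.
have le_total x y : le x y \/ le y x by apply/orP; exact: (wo_chainW wo).
have le_trans y x z : le x y -> le y z -> le x z.
  move=> xy yz; have [|w [[]]] := le_ini.1 [pred u | u \in [:: x; y; z]].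
    by exists x; rewrite !inE eqxx.
  rewrite !inE => wxyz wmin _.
  have [wx wy wz] : [/\ le w x, le w y & le w z].
    by split; apply: wmin; rewrite !inE eqxx ?orbT.
  case/or3P: wxyz => /eqP e; rewrite {}e in wx wy wz => //.
    by rewrite (le_anti _ _ xy wx).
  by rewrite -(le_anti _ _ yz wy).
have [x0 _] : exists x : K, True.
  apply: contrapT => nK; apply: Kunc; suff -> : [set: K] = set0 by [].
  by apply/seteqP; split=> // x _; case: nK; exists x.
have cex n : exists x, forall y, C y -> g y = n -> y = x.
  have [[y [Cy yn]]|nex] := pselect (exists y, C y /\ g y = n); last first.
    by exists x0 => y Cy yn; case: nex; exists y.
  by exists y => z Cz zn; apply: gI; rewrite ?inE// zn.
have [c cP] := choice cex.
pose m := fix m n := if n is n'.+1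
  then if le (m n') (c n) then c n else m n' else c 0.
have mS n : le (m n) (m n.+1) by rewrite /=; case: ifP => // _; exact: le_refl.
exists (fun n => [set y | le y (m n)]); split.
- by move=> n; exact: closed_segment_small.
- by move=> n y /= yn; exact: le_trans yn (mS n).
- apply/seteqP; split=> // x _; have [y Cy xy] := Ccof x; exists (g y) => //=.
  apply: le_trans xy _; rewrite [y in le y _](cP _ y Cy erefl).
  case: (g y) => [|n] /=; first exact: le_refl.
  by case: ifPn => [_|]; [exact: le_refl|have [->|] := le_total (m n) (c n.+1)].
Qed.
End Segments.

(** * Vectors of the l1 space *)

Import Order.TTheory GRing.Theory Num.Theory.
Import numFieldNormedType.Exports.
Local Open Scope ring_scope.

Section Ell1Theory.
Variables (R : realType) (K : choiceType).
Implicit Types (f g z : ell1 R K) (a i : K).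

Lemma EFin_ell1_norm f : `|f|%:E = esum_norm f.
Proof. exact: ell1_normE. Qed.

Lemma ell1_coordD f g i : (f + g) i = f i + g i.
Proof. by []. Qed.

Lemma ell1_coordB f g i : (f - g) i = f i - g i.
Proof. by []. Qed.

Lemma ell1_ext f g : (forall i, f i = g i) -> f = g.
Proof. by move=> fg; apply/val_inj/funext. Qed.

Lemma le_ell1_norm f g : (forall i, `|f i| <= `|g i|) -> `|f| <= `|g|.
Proof.
move=> fg; rewrite -lee_fin !EFin_ell1_norm; apply: le_esum => i _.
by rewrite lee_fin.
Qed.

Lemma ler_coord_norm f i : `|f i| <= `|f|.
Proof.
rewrite -lee_fin EFin_ell1_norm; apply: esum_ge; exists [set i]; first by split.
by rewrite fsbig_set1.
Qed.

(** The l1 norm is additive on vectors without cancellation, such as disjointly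
supported vectors and vectors of equal sign. *)
Lemma ell1_norm_add f g : (forall i, `|f i + g i| = `|f i| + `|g i|) ->
  `|f + g| = `|f| + `|g|.
Proof.
move=> fg; apply: EFin_inj; rewrite EFinD !EFin_ell1_norm /esum_norm -esumD//.
by apply: eq_esum => i _; rewrite /= -EFinD; congr EFin; exact: fg.
Qed.

Lemma ell1_bounded (M : R) (h : K -> R) :
  (forall r : seq K, uniq r -> \sum_(i <- r) `|h i| <= M) ->
  h \in @ell1_pred R K.
Proof.
move=> hM; rewrite inE; apply: le_lt_trans (ltry M).
apply: ge_ereal_sup => _ [X [finX _] <-].
rewrite fsbig_finite//= sumEFin lee_fin; apply: hM; exact: finmap.fset_uniq.
Qed.

Lemma ell1_restrict_subproof (r : seq K) f :
  (fun i => if i \in r then f i else 0) \in @ell1_pred R K.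
Proof.
have := ell1P f; rewrite !inE; apply: le_lt_trans; apply: le_esum => i _.
by rewrite lee_fin; case: ifP => // _; rewrite normr0.
Qed.

Definition ell1_restrict r f := Ell1 (ell1_restrict_subproof r f).

Lemma esum_norm_delta (t : R) a :
  esum_norm (fun i => if i == a then t else 0) = `|t|%:E.
Proof.
rewrite /esum_norm (eq_esum (b := fun i =>
  if i \in [set a] then `|t|%:E else 0%E)) => [|i _].
  by rewrite -esum_mkcond esum_set1.
by rewrite in_set1 /=; case: ifP => // _; rewrite normr0.
Qed.

Lemma delta_subproof (t : R) a :
  (fun i => if i == a then t else 0) \in @ell1_pred R K.
Proof.
by rewrite inE; have := ltry `|t|; rewrite -(esum_norm_delta t a).
Qed.

Definition delta t a : ell1 R K := Ell1 (delta_subproof t a).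

Lemma norm_delta t a : `|delta t a| = `|t|.
Proof. by apply: EFin_inj; rewrite EFin_ell1_norm; exact: esum_norm_delta. Qed.

Lemma norm_add_delta f t a : 0 <= f a -> 0 <= t ->
  `|f + delta t a| = `|f| + t.
Proof.
move=> fa t0; rewrite ell1_norm_add ?norm_delta ?(ger0_norm t0)// => i /=.
case: eqP => [->|_]; last by rewrite addr0 normr0 addr0.
by rewrite !ger0_norm// addr_ge0.
Qed.

(** The indices and the coefficients are kept in separate lists: below, the
vectors with given indices must form a family indexed by a countable type. *)
Definition rational_comb (l : seq K) (q : seq rat) : ell1 R K :=
  \sum_(u <- zip l q) delta (ratr u.2) u.1.

Lemma restrict_approx r f (e : R) : 0 < e -> uniq r ->
  exists q, `|ell1_restrict r f - rational_comb r q| < e.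
Proof.
elim: r e => [|a r IH] e e0 /=.
  move=> _; exists [::]; rewrite /rational_comb big_nil.
  suff -> : ell1_restrict [::] f = 0 by rewrite subr0 normr0.
  exact: ell1_ext.
move=> /andP[ar ur]; have e2 : 0 < e / 2 by rewrite divr_gt0.
have [q qr] := IH _ e2 ur.
have [b] : exists b, ratr b \in `]f a - e / 2, f a + e / 2[%R.
  by apply: rat_in_itvoo; lra.
rewrite in_itv/= => /andP[b1 b2]; exists (b :: q).
rewrite /rational_comb /= big_cons /= -/(rational_comb r q).
have -> : ell1_restrict (a :: r) f = delta (f a) a + ell1_restrict r f.
  apply: ell1_ext => i; rewrite ell1_coordD /= inE.
  by case: eqP => [->|_] /=; rewrite ?(negPf ar) ?addr0 ?add0r.
rewrite opprD addrACA.
have -> : delta (f a) a - delta (ratr b) a = delta (f a - ratr b) a.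
  apply: ell1_ext => i; rewrite ell1_coordB /=.
  by case: eqP => // _; rewrite subr0.
apply: le_lt_trans (ler_normD _ _) _; rewrite norm_delta.
have : `|f a - ratr b| < e / 2 by rewrite ltr_norml; lra.
lra.
Qed.

(** A finite set carries all but e / 2 of the norm of f; restricting f to it
costs the remaining e / 2, since norms of disjointly supported vectors add. *)
Lemma rational_comb_dense f (e : R) : 0 < e ->
  exists l q, `|f - rational_comb l q| < e.
Proof.
move=> e0; have e2 : 0 < e / 2 by rewrite divr_gt0.
have : (`|f|%:E - (e / 2)%:E < esum_norm f)%E.
  by rewrite -EFin_ell1_norm -EFinB lte_fin; lra.
move=> /ereal_sup_gt[_ [X [finX _] <-]].
pose r : seq K := finmap.enum_fset (fset_set X).
have ur : uniq r by exact: finmap.fset_uniq.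
rewrite fsbig_finite//= sumEFin -EFinB lte_fin -/r => rf.
have [q qr] := restrict_approx f e2 ur; exists r, q.
have fr : `|f| = `|f - ell1_restrict r f| + `|ell1_restrict r f|.
  rewrite -ell1_norm_add ?subrK// => i; rewrite ell1_coordB /=.
  by case: ifP => _; rewrite ?subrr ?subr0 ?normr0 ?addr0 ?add0r.
have le_r : \sum_(i <- r) `|f i| <= `|ell1_restrict r f|.
  rewrite -lee_fin EFin_ell1_norm; apply: esum_ge; exists X; first by split.
  rewrite fsbig_finite//= sumEFin lee_fin -/r !big_seq.
  by apply: ler_sum => i ir; rewrite ir.
rewrite -(subrK (ell1_restrict r f) f) -addrA.
apply: le_lt_trans (ler_normD _ _) _; lra.
Qed.

Definition support_set (X : set (ell1 R K)) : set K :=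
  [set i | exists2 x, X x & x i != 0].

Lemma rational_comb_coord l q i : i \notin l -> rational_comb l q i = 0.
Proof.
rewrite /rational_comb; elim: l q => [|a l IH] [|b q]; rewrite /= ?big_nil//.
rewrite inE negb_or => /andP[ia il].
by rewrite big_cons ell1_coordD IH//= (negPf ia) addr0.
Qed.

(** A nonzero coordinate of f must occur in a rational combination that
approximates f well enough, and countably many of these suffice. *)
Lemma countable_support1 f : countable [set i | f i != 0].
Proof.
have ex n : exists l q, `|f - rational_comb l q| < n.+1%:R^-1.
  by apply: rational_comb_dense; rewrite invr_gt0.
have [l lP] := choice ex.
apply: (@sub_countable _ _ _ (\bigcup_n [set` l n])); last first.
  apply: bigcup_countable => // n _; exact/finite_set_countable/finite_seq.
apply: subset_card_le => i /= fi; apply: contrapT => il.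
have : 0 < `|f i| by rewrite normr_gt0.
move=> /(ltr_add_invr)[n]; rewrite add0r => nf.
have [q] := lP n; apply/negP; rewrite -leNgt.
apply: le_trans (ler_coord_norm _ i); rewrite ell1_coordB rational_comb_coord.
  by rewrite subr0 ltW.
by apply/negP => iln; apply: il; exists n.
Qed.

Lemma countable_support X : separable_set X -> countable (support_set X).
Proof.
move=> [D [Dc _ XD]].
apply: (@sub_countable _ _ _ (\bigcup_(d in D) [set i | d i != 0])); last first.
  by apply: bigcup_countable => // d _; exact: countable_support1.
apply: subset_card_le => i /= [x Xx xi].
have xi0 : 0 < `|x i| by rewrite normr_gt0.
have [d [Dd]] := XD x Xx _ (nbhsx_ballx x _ xi0).
rewrite -ball_normE /= => xd; exists d => //=; apply: contraTneq xd => di.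
rewrite -leNgt; apply: le_trans (ler_coord_norm _ i).
by rewrite ell1_coordB di subr0.
Qed.

(** The coordinatewise limit w is summable because each finite partial sum of
its entries is a limit of partial sums bounded by M. *)
Lemma ell1_monotone_limit (z : nat -> ell1 R K) (M : R) :
  (forall n i, 0 <= z n i) -> (forall n i, z n i <= z n.+1 i) ->
  (forall n, `|z n| <= M) ->
  exists w : ell1 R K, (forall n i, z n i <= w i) /\
    forall n i, (forall m, (n <= m)%N -> z m i = z n i) -> w i = z n i.
Proof.
move=> z0 zS zM.
have zcvg i : cvgn (fun n => z n i).
  apply: nondecreasing_is_cvgn; first by apply/nondecreasing_seqP => n.
  exists M => _ [n _ <-]; apply: le_trans (zM n).
  by apply: le_trans (ler_coord_norm _ i); rewrite ler_norm.
pose h i := limn (fun n => z n i).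
have hle n i : z n i <= h i.
  by apply: nondecreasing_cvgn_le => //; apply/nondecreasing_seqP => m.
have hE : h \in @ell1_pred R K.
  apply: (@ell1_bounded M) => r ur.
  have hc : (fun n => \sum_(i <- r) z n i) @ \oo --> \sum_(i <- r) `|h i|.
    apply: cvg_big => [|i _]; first exact: add_continuous.
    rewrite ger0_norm; [exact: zcvg|exact: le_trans (hle 0%N i)].
  rewrite -(cvg_lim _ hc)//; apply: limr_le.
    by apply/cvg_ex; eexists; exact: hc.
  apply: nearW => n; apply: le_trans (zM n).
  rewrite -lee_fin EFin_ell1_norm; apply: esum_ge; exists [set` r].
    by split=> //; exact: finite_seq.
  rewrite -fsbig_seq//= sumEFin lee_fin.
  by apply: ler_sum => i _; exact: ler_norm.
exists (Ell1 hE); split=> // n i zn.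
apply: cvg_lim => //; apply: cvg_near_cst; exists n => // m /= nm; exact: zn.
Qed.
End Ell1Theory.

(** * The path through the tiles *)

Section TilePath.
Variables (R : realType) (K : choiceType).
Variables (T : set (set (ell1 R K))) (tile : ell1 R K -> set (ell1 R K)).
Variable (X : set (ell1 R K) -> set (ell1 R K)).
Hypothesis tileP : forall z, T (tile z) /\ tile z z.
Hypothesis T_disj : forall A z, T A -> A z -> tile z = A.
Hypothesis T_ball :
  forall A, T A -> forall z, A z <-> exists2 x, X A x & `|z - x| <= 1.

(** Distance at least 1 - e from all centres: z is deep inside no tile. *)
Definition far (e : R) (z : ell1 R K) :=
  forall A x, T A -> X A x -> 1 - e <= `|z - x|.

(** Moving along a fresh coordinate increases the distance to the centres of the
current tile at unit speed.  As this distance is at least 1 - 2 e initially, one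
of the first three steps of length e leaves the tile.  Before that step the
point is still in the tile of z, hence at distance more than 1 from all other
centres, and one step costs at most e of this. *)
Lemma leave_tile (z : ell1 R K) (e : R) (a : K) :
  (forall i, 0 <= z i) -> 0 < e -> far (2 * e) z ->
  ~ support_set (X (tile z)) a ->
  exists t, [/\ 0 <= t, t <= 3 * e, ~ tile z (z + delta t a) &
    far e (z + delta t a)].
Proof.
move=> z0 e0 zfar aX; have [Tz zz] := tileP z.
have normE t x : 0 <= t -> X (tile z) x -> `|z + delta t a - x| = `|z - x| + t.
  move=> t0 Xx; rewrite addrAC norm_add_delta// ell1_coordB.
  suff -> : x a = 0 by rewrite subr0.
  by apply/eqP; apply: contra_notT aX => xa; exists x.
have step t : 0 <= t -> t <= 2 * e -> tile z (z + delta t a) ->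
    ~ tile z (z + delta (t + e) a) -> exists t, [/\ 0 <= t, t <= 3 * e,
      ~ tile z (z + delta t a) & far e (z + delta t a)].
  move=> t0 t2 zt zte; exists (t + e); split=> //; [lra|lra|].
  move=> A x TA Ax; have [Az|Az] := pselect (A = tile z).
    rewrite {}Az in TA Ax *; apply: contra_notT zte; rewrite -ltNge => xe.
    by apply/(T_ball Tz); exists x => //; lra.
  have : 1 < `|z + delta t a - x|.
    rewrite ltNge; apply/negP => xt; apply: Az.
    rewrite -(T_disj Tz zt); apply/esym/T_disj => //.
    by apply/(T_ball TA); exists x.
  have -> : delta (t + e) a = delta t a + delta e a :> ell1 R K.
    apply: ell1_ext => i; rewrite ell1_coordD /=.
    by case: eqP => _; rewrite ?addr0.
  have -> : z + delta t a - x = z + (delta t a + delta e a) - x - delta e a.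
    by rewrite (addrAC _ (- x)) addrA addrK.
  move=> /lt_le_trans/(_ (ler_normB _ _)); rewrite norm_delta (gtr0_norm e0).
  by lra.
have zt0 : tile z (z + delta 0 a).
  suff -> : delta 0 a = 0 :> ell1 R K by rewrite addr0.
  by apply: ell1_ext => i; rewrite /= if_same.
have [z1|/(step 0)] := pselect (tile z (z + delta (0 + e) a)); last first.
  by apply => //; lra.
have [z2|/(step _)] := pselect (tile z (z + delta (0 + e + e) a)); last first.
  by apply => //; lra.
have [z3|/(step _)] := pselect (tile z (z + delta (0 + e + e + e) a));
  last by apply => //; lra.
move: z3 => /(T_ball Tz)[x Xx]; rewrite normE//; last lra.
have := zfar _ _ Tz Xx; lra.
Qed.

Hypothesis T_nonempty : forall A, T A -> exists x, X A x.
Hypothesis X_countable : forall A, T A -> countable (support_set (X A)).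
Variable L : nat -> set K.
Hypothesis K_uncountable : ~ countable [set: K].
Hypothesis L_small : forall n, ~ ([set: K] #<= L n)%card.
Hypothesis L_incr : forall n, L n `<=` L n.+1.
Hypothesis L_cover : \bigcup_n L n = setT.

Let L_homo : {homo L : m n / (m <= n)%N >-> m `<=` n}.
Proof.
apply: homo_leq L_incr => [A|B A C]; [exact: subset_refl|exact: subset_trans].
Qed.

Lemma seq_sub_exhaustion (l : seq K) : exists n, forall x, x \in l -> L n x.
Proof.
elim: l => [|a l [n ln]]; first by exists 0%N.
have [m _ Lma] : (\bigcup_n L n) a by rewrite L_cover.
exists (maxn m n) => x; rewrite inE => /predU1P[->|/ln].
  exact: L_homo (leq_maxl _ _) _ Lma.
exact: L_homo (leq_maxr _ _) _.
Qed.

(** A fresh coordinate avoids the current tile, so as to leave it, and all tiles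
handled at stage n, so as not to enter them. *)
Definition fresh n z a := ~ support_set (X (tile z)) a /\
  forall l q, (forall x, x \in l -> L n x) ->
  ~ support_set (X (tile (rational_comb R l q))) a.

(** The sets of small_index_union are here indexed by the lists of indices of
rational combinations: such a list belongs to countably many combinations. *)
Lemma fresh_exists n z : exists a, fresh n z a.
Proof.
pose F l := support_set (X (tile z)) `|`
  \bigcup_(q : seq rat) support_set (X (tile (rational_comb R l q))).
have Fc l : countable (F l).
  rewrite /F -bigcup2E; apply: bigcup_countable => //.
  case=> [|[|n']] _ /=; [exact/X_countable/(tileP _).1| |exact: countable0].
  apply: bigcup_countable => // q _; exact/X_countable/(tileP _).1.
have [a aF] := small_index_union K_uncountable (@L_small n) Fc.
exists a; split=> [az|l q lL aq]; first by apply: (aF [::]) => //; left.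
by apply: (aF l) => //; right; exists q.
Qed.

(** Iterating leave_tile with e = 2^-n at stage n: the invariant is that z_n is
at distance at least 1 - 2 * 2^-n from all centres, which is void for n = 0.
Moves of length at most 3 * 2^-n at stage n keep the norm of z_n at most
6 - 6 * 2^-n. *)
Lemma tile_path : exists z : nat -> ell1 R K, exists a : nat -> K,
  [/\ forall n i, 0 <= z n i, forall n, `|z n| <= 6,
    forall n i, z n i <= z n.+1 i, forall n i, i != a n -> z n.+1 i = z n i &
    forall n, fresh n (z n) (a n) /\ ~ tile (z n) (z n.+1)].
Proof.
pose e n : R := 2^-1 ^+ n.
have e_gt0 n : 0 < e n by rewrite exprn_gt0.
have eS n : e n = 2 * e n.+1 by rewrite /e exprS; lra.
have stepex (nz : nat * ell1 R K) : exists ta : K * R,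
    fresh nz.1 nz.2 ta.1 /\
    ((forall i, 0 <= nz.2 i) -> far (2 * e nz.1) nz.2 ->
    [/\ 0 <= ta.2, ta.2 <= 3 * e nz.1, ~ tile nz.2 (nz.2 + delta ta.2 ta.1) &
      far (e nz.1) (nz.2 + delta ta.2 ta.1)]).
  case: nz => n z; have [a az] := fresh_exists n z.
  have [[z0 zf]|nz] := pselect ((forall i, 0 <= z i) /\ far (2 * e n) z).
    have [t tP] := leave_tile z0 (e_gt0 n) zf az.1.
    by exists (a, t).
  by exists (a, 0); split=> // z0 zf; case: nz.
have [f fP] := choice stepex.
have [z z_0 zS] : exists2 z : nat -> ell1 R K, z 0%N = 0 &
    forall n, z n.+1 = z n + delta (f (n, z n)).2 (f (n, z n)).1.
  by exists (fix z n := if n is n'.+1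
    then z n' + delta (f (n', z n')).2 (f (n', z n')).1 else 0).
have inv n : [/\ forall i, 0 <= z n i, far (2 * e n) (z n) &
    `|z n| <= 6 - 6 * e n].
  elim: n => [|n [z0 zf zn]].
    rewrite z_0; split=> //; last by rewrite normr0 /e expr0; lra.
    by move=> A x _ _; rewrite /e expr0; apply: le_trans (normr_ge0 _); lra.
  have [_ /(_ z0 zf)/=[t0 t3 _ tf]] := fP (n, z n).
  rewrite zS; split; last 2 first.
  - by rewrite -eS.
  - apply: le_trans (ler_normD _ _) _; rewrite norm_delta ger0_norm//.
    by have := eS n; lra.
  - by move=> i; rewrite ell1_coordD addr_ge0//=; case: ifP.
exists z, (fun n => (f (n, z n)).1); split.
- by move=> n i; have [] := inv n.
- by move=> n; have [_ _ /le_trans] := inv n; apply; have := e_gt0 n; lra.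
- move=> n i; have [z0 zf _] := inv n.
  have [_ /(_ z0 zf)/=[t0 _ _ _]] := fP (n, z n).
  by rewrite zS ell1_coordD lerDl /=; case: ifP.
- by move=> n i ia; rewrite zS ell1_coordD /= (negPf ia) addr0.
- move=> n; have [z0 zf _] := inv n.
  have [fr /(_ z0 zf)/=[_ _ nt _]] := fP (n, z n).
  by rewrite zS; split.
Qed.

(** The limit w lies in no tile: from some stage n on, the tile A of w only sees
coordinates already settled, so A contains z_n and z_n+1, whereas the path
leaves the tile of z_n at stage n. *)
Lemma no_point_left : False.
Proof.
have [z [a [z0 zM zS za zT]]] := tile_path.
have [w [zw wE]] := ell1_monotone_limit z0 zS zM.
have [Tw ww] := tileP w; set A := tile w in Tw ww *.
have [y Ay] := T_nonempty Tw.
have [l [q yq]] := rational_comb_dense y (ltr01 : 0 < 1 :> R).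
have lqA : tile (rational_comb R l q) = A.
  by apply: T_disj => //; apply/(T_ball Tw); exists y => //; rewrite distrC ltW.
have [n ln] := seq_sub_exhaustion l.
(* From stage n on, the path moves off the support of A. *)
have aA m : (n <= m)%N -> ~ support_set (X A) (a m).
  move=> nm; have [[_ /(_ l q) fr] _] := zT m.
  by rewrite lqA in fr; apply: fr => x /ln; exact: L_homo.
have zconst m k i : (n <= m)%N -> (m <= k)%N -> support_set (X A) i ->
    z k i = z m i.
  move=> nm mk Ai; elim: k mk => [|k IH]; first by rewrite leqn0 => /eqP->.
  rewrite leq_eqVlt ltnS => /predU1P[->//|mk]; rewrite za ?IH//.
  by apply/eqP => ia; apply: (aA k); [exact: leq_trans nm mk|rewrite -ia].
have Az m : (n <= m)%N -> A (z m).
  move=> nm; have /(T_ball Tw)[x Ax wx] := ww.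
  apply/(T_ball Tw); exists x => //; apply: le_trans wx.
  apply: le_ell1_norm => i.
  rewrite !ell1_coordB.
  have [Ai|Ai] := pselect (support_set (X A) i).
    by rewrite (wE m i)// => k mk; exact: zconst.
  have -> : x i = 0 by apply/eqP; apply: contra_notT Ai => xi; exists x.
  by rewrite !subr0 !ger0_norm//; exact: le_trans (z0 m i) (zw m i).
have := (zT n).2; rewrite (T_disj Tw (Az n (leqnn n))); apply.
exact: Az.
Qed.

End TilePath.

(** * Tilings of the l1 space *)

Theorem theorem1p2 (R : realType) (K : choiceType)
    (K_uncountable : ~ countable [set: K])
    (K_cof : countable_cofinality K) :
  ~ exists T : set (set (ell1 R K)),
      [/\ normal_tiling T, disjoint_tiling T &
        forall A, T A -> body A /\
          exists X : set (ell1 R K),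
            [/\ closed X, separable_set X &
                A = sum_set X (unit_ball (ell1 R K))]].
Proof.
move=> [T [_ [[Tcover _ Tint _] Tdisj] Tform]].
have [le le_ini [C Cc Ccof]] := K_cof.
have [L [L_small L_incr L_cover]] :=
  small_exhaustion K_uncountable le_ini Cc Ccof.
have tex z : exists A, T A /\ A z.
  have [A TA Az] : (\bigcup_(A in T) A) z by rewrite Tcover.
  by exists A.
have [tile tileP] := choice tex.
have Xex A : exists X, T A -> separable_set X /\
    A = sum_set X (unit_ball (ell1 R K)).
  have [TA|nTA] := pselect (T A); last by exists set0.
  by have [_ [X [_ Xs AX]]] := Tform A TA; exists X.
have [X XP] := choice Xex.
have T_disj A z : T A -> A z -> tile z = A.
  by move=> TA Az; have [Tz zz] := tileP z; apply: Tdisj => //; exists z.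
have T_ball A : T A -> forall z, A z <-> exists2 x, X A x & `|z - x| <= 1.
  move=> TA z; rewrite {1}(XP A TA).2; split=> [[x Xx [b b1 <-]]|[x Xx zx]].
    by exists x => //; rewrite addrC addKr.
  by exists x => //; exists (z - x) => //; rewrite addrC subrK.
have T_nonempty A : T A -> exists x, X A x.
  move=> TA; have [z /interior_subset Az] := Tint A TA.
  by have [x Xx _] := (T_ball A TA z).1 Az; exists x.
apply: (no_point_left tileP T_disj T_ball T_nonempty _ K_uncountable
  L_small L_incr L_cover).
by move=> A TA; apply: countable_support; exact: (XP A TA).1.
Qed.
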